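(* Let $k\geq 1$ be an integer and let $G=\overrightarrow{GL}(\mathbb{Z}_{2k})$ be the group of affine bijections of $\mathbb{Z}_{2k}$. Let $\mathcal{R}_{G}$ be a $G$-strong antichain (with $S=\mathbb{Z}_{2k}$). Then $$|\mathcal{R}_{G}|\leq 2^{k-1}.$$
   Context: $\overrightarrow{GL}(\mathbb{Z}_{2k})=\mathbb{Z}_{2k}\ltimes \mathbb{Z}_{2k}^{\times}$ is the group, under composition, of all affine functions $e^{u}v:\mathbb{Z}_{2k}\to\mathbb{Z}_{2k}$, $x\mapsto vx+u$, with $u\in\mathbb{Z}_{2k}$ and $v\in\mathbb{Z}_{2k}^{\times}$ (the units of $\mathbb{Z}_{2k}$). Put $S=\mathbb{Z}_{2k}$ and $G=\overrightarrow{GL}(\mathbb{Z}_{2k})$, acting on subsets of $S$ by $gA:=\{ga : a\in A\}$. A dichotomy is a subset $D\subseteq S$ with $|D|=|S|/2=k$. A dichotomy $D$ is $G$-rigid if $gD=D$ with $g\in G$ implies $g=e$; it is $G$-autocomplementary if there exists $p\in G$ with $pD=S\setminus D$; it is $G$-strong if it is both $G$-rigid and $G$-autocomplementary. A traversal of the set of $G$-orbits of dichotomies is a set of dichotomies consisting of exactly one element from each $G$-orbit of dichotomies. A $G$-strong antichain is a subset $\mathcal{R}_G$ of such a traversal all of whose members are $G$-strong. *)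

(* Defs.v *)
From mathcomp Require Import all_boot all_order all_algebra all_fingroup.

Set Implicit Arguments.
Unset Strict Implicit.
Unset Printing Implicit Defensive.

Import GRing.Theory.

(* ['Z_n] is the ring of integers modulo n only for n > 1. *)
Lemma affine_inj n (u : 'Z_n) (v : {unit 'Z_n}) :
  injective (fun x : 'Z_n => val v * x + u)%R.
Proof. by move=> x y /addIr; apply: (mulrI (valP v)). Qed.

Definition affine_perm n (u : 'Z_n) (v : {unit 'Z_n}) : {perm 'Z_n} :=
  perm (affine_inj (u := u) (v := v)).

(* The product of permutations composes from left to right, so this is the
   group of affine maps with the opposite multiplication; images, orbits,
   stabilisers and the neutral element do not depend on this choice. *)
Definition affine_set n : {set {perm 'Z_n}} :=
  [set affine_perm p.1 p.2 | p : 'Z_n * {unit 'Z_n}].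

Lemma affine_group_set n : group_set (affine_set n).
Proof.
apply/group_setP; split.
  apply/imsetP; exists (0%R, 1%g) => //.
  by apply/permP => x; rewrite perm1 permE /= mul1r addr0.
move=> s t /imsetP[[u v] _ ->] /imsetP[[u' v'] _ ->].
apply/imsetP; exists ((val v' * u + u')%R, (v' * v)%g) => //.
by apply/permP => x; rewrite permM !permE /= mulrDr mulrA addrA.
Qed.

Canonical affine_group n : {group {perm 'Z_n}} := Group (affine_group_set n).

Definition dichotomies (S : finType) : {set {set S}} :=
  [set D : {set S} | #|D|.*2 == #|S|].

Definition rigid (S : finType) (G : {group {perm S}}) (D : {set S}) : Prop :=
  forall g : {perm S}, g \in G -> g @: D = D -> g = 1%g.

Definition autocomplementary (S : finType) (G : {group {perm S}})
    (D : {set S}) : Prop :=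
  exists2 p : {perm S}, p \in G & p @: D = ~: D.

Definition strong (S : finType) (G : {group {perm S}}) (D : {set S}) : Prop :=
  rigid G D /\ autocomplementary G D.

(* ['P^*] is the action of permutations on subsets by direct image. *)
Definition dichotomy_orbits (S : finType) (G : {group {perm S}}) :
    {set {set {set S}}} :=
  [set orbit 'P^* G D | D in dichotomies S].

Definition traversal (S : finType) (G : {group {perm S}})
    (T : {set {set S}}) : Prop :=
  is_transversal T (dichotomy_orbits G) (dichotomies S).

Definition strong_antichain (S : finType) (G : {group {perm S}})
    (A : {set {set S}}) : Prop :=
  exists T : {set {set S}},
    [/\ traversal G T, A \subset T & forall D, D \in A -> strong G D].

(* Main.v *)
Require Import Defs.
From mathcomp Require Import all_boot all_order all_algebra all_fingroup.

(** Count the strong dichotomies in two ways.  By rigidity, the orbit of each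
    member of the antichain has [#|G|] elements, and different members lie in
    different orbits, so there are at least [#|A| * #|G|] dichotomies [g D]
    with [D] in [A] and [g] in [G].  Each of them is sent to its complement by
    some [q] in [G]; by rigidity [q ^ 2 = 1], and [q] clearly has no fixed
    point.  A given [q] exchanges at most [2 ^ k] sets with their complements,
    since such a set is determined by its trace on any one of them, which has
    [k] elements.  So [#|A| * #|G|] is at most [2 ^ k] times the number of
    fixed-point-free involutions of [G] ([strong_antichain_bound]).

    For the affine group, at most half of the elements are fixed-point-free
    involutions ([card_affine_fpf_involutions]): following one of them by the
    translation [x |-> x + 1] never gives another.  Hence [#|A|] is at most
    [2 ^ k / 2]. *)

Section StrongAntichains.

Context {S : finType}.
Implicit Types (G : {group {perm S}}) (A : {set {set S}}) (D E : {set S}).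
Implicit Types (p q g : {perm S}).

Definition fpf_involutions G : {set {perm S}} :=
  [set p in G | (p * p == 1)%g && [forall x, p x != x]].

Lemma mem_swapped q E x : q @: E = ~: E -> (q x \in E) = (x \notin E).
Proof.
move=> qE; have := mem_imset E x (@perm_inj _ q).
by rewrite qE inE => <-; rewrite negbK.
Qed.

(** If [q] exchanges [E0] with its complement, then any other set [E] exchanged
    with its complement is determined by [E :&: E0]: a point outside [E0] is
    sent by [q] into [E0], and lies in [E] exactly if its image does not. *)
Lemma card_swapped q :
  #|[set E : {set S} | q @: E == ~: E]| <= 2 ^ (#|S|)./2.
Proof.
have [->|[E0]] := set_0Vmem [set E : {set S} | q @: E == ~: E].
  by rewrite cards0.
rewrite inE => /eqP qE0.
have cardE0 : #|E0| = (#|S|)./2.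
  have cardC : #|~: E0| = #|E0| by rewrite -qE0 card_imset //; apply: perm_inj.
  by rewrite -(cardsC E0) cardC addnn doubleK.
rewrite -cardE0 -card_powerset.
rewrite -(@card_in_imset _ _ (fun E => E :&: E0)).
  apply/subset_leq_card/subsetP => _ /imsetP[E _ ->].
  by rewrite powersetE subsetIr.
move=> E F; rewrite !inE => /eqP qE /eqP qF /setP eqEF.
have eq_on_E0 x : x \in E0 -> (x \in E) = (x \in F).
  by move=> xE0; have := eqEF x; rewrite !inE xE0 !andbT.
apply/setP => x; have [/eq_on_E0 //|xE0] := boolP (x \in E0).
apply: negb_inj; rewrite -(mem_swapped _ _ _ qE) -(mem_swapped _ _ _ qF).
by apply: eq_on_E0; rewrite (mem_swapped _ _ _ qE0).
Qed.

(** If [p] takes [D] to its complement, its conjugate by [g] does so for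
    [g @: D]; moreover [p * p] stabilises [D], so it is trivial when [D] is
    rigid. *)
Lemma strong_translate_swapped G D g : strong G D -> g \in G ->
  exists2 q, q \in fpf_involutions G & q @: (g @: D) = ~: (g @: D).
Proof.
case=> rigD [p pG pD] gG.
have swapD := mem_swapped _ _ ^~ pD.
have pp1 : (p * p = 1)%g.
  apply: rigD; first exact: groupM.
  apply/setP => x; rewrite -(permKV (p * p)%g x).
  rewrite mem_imset; last exact: perm_inj.
  by rewrite permM !swapD negbK.
exists (p ^ g)%g; last first.
  apply/setP => x; rewrite -(permKV g x); set y := (g^-1)%g x.
  have gy_image : g y = (p ^ g)%g (g (p y)).
    by rewrite permJ -(permM p p) pp1 perm1.
  rewrite inE {1}gy_image !mem_imset; try exact: perm_inj.
  exact: swapD.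
rewrite inE groupJ //= -conjMg pp1 conj1g eqxx /=.
apply/forallP => x; rewrite -(permKV g x) permJ (inj_eq (@perm_inj _ g)).
apply/eqP => fixed; have := swapD ((g^-1)%g x).
by rewrite fixed; case: (_ \in _).
Qed.

(** A traversal meets the orbit of each of its members once. *)
Lemma traversal_orbit_inj G (T : {set {set S}}) D E g :
  traversal G T -> D \in T -> E \in T -> g \in G -> g @: D = E -> D = E.
Proof.
case/and3P=> _ sTD /forall_inP one DT ET gG gDE.
have /one/cards1P[F defF] : orbit ('P^*)%act G D \in dichotomy_orbits G.
  by apply: imset_f; apply: (subsetP sTD).
have: D \in T :&: orbit ('P^*)%act G D by rewrite inE DT orbit_refl.
have: E \in T :&: orbit ('P^*)%act G D.
  by rewrite inE ET; apply/orbitP; exists g.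
by rewrite defF !inE => /eqP-> /eqP->.
Qed.

Lemma strong_antichain_bound G A : strong_antichain G A ->
  #|A| * #|G| <= #|fpf_involutions G| * 2 ^ (#|S|)./2.
Proof.
case=> T [trT sAT strA].
pose translate (Dg : {set S} * {perm S}) := Dg.2 @: Dg.1.
rewrite -cardsX -(@card_in_imset _ _ translate).
  have covered : translate @: setX A G \subset
      \bigcup_(q in fpf_involutions G) [set E : {set S} | q @: E == ~: E].
    apply/subsetP => _ /imsetP[[D g] /setXP[/= DA gG] ->].
    rewrite /translate /=.
    have [q qI qgD] := strong_translate_swapped _ _ _ (strA D DA) gG.
    by apply/bigcupP; exists q => //; rewrite inE qgD.
  apply: leq_trans (subset_leq_card covered) _.
  rewrite -sum_nat_const.
  apply: (@leq_trans (\sum_(q in fpf_involutions G)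
      #|[set E : {set S} | q @: E == ~: E]|)).
    elim/big_rec2: _ => [|q m U _ leUm]; first by rewrite cards0.
    by apply: leq_trans (leq_card_setU _ _) _; rewrite leq_add2l.
  by apply: leq_sum => q _; apply: card_swapped.
move=> [D g] [E h] /setXP[/= DA gG] /setXP[/= EA hG].
rewrite /translate /= => eqgh.
have ghDE : (g * h^-1)%g @: D = E.
  have -> : (g * h^-1)%g @: D = (h^-1)%g @: (g @: D).
    by rewrite -imset_comp; apply: eq_imset => x; rewrite /= permM.
  rewrite eqgh -imset_comp -[RHS]imset_id.
  by apply: eq_imset => x; rewrite /= permK.
have ghG : (g * h^-1)%g \in G by rewrite groupM ?groupV.
have DE : D = E.
  by apply: traversal_orbit_inj trT _ _ ghG ghDE; apply: (subsetP sAT).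
have [rigD _] := strA D DA.
have gh1 : (g * h^-1 = 1)%g by apply: rigD => //; rewrite ghDE.
by rewrite -DE; congr pair; apply/eqP; rewrite eq_mulgV1 gh1.
Qed.

End StrongAntichains.

Import GRing.Theory.

(** Suppose that [x |-> v x + u] and [x |-> v x + u + 1] are both involutions.
    Then [(v + 1) u = 0 = (v + 1) (u + 1)], so that [v = -1], and the fixed
    points are the solutions of [2 x = u], respectively [2 x = u + 1].  One of
    [u] and [u + 1] is a double, so one of the two maps has a fixed point.
    Therefore the fixed-point-free involutions are disjoint from their coset by
    the translation [x |-> x + 1]. *)
Lemma card_affine_fpf_involutions n :
  (#|fpf_involutions (affine_group n)|).*2 <= #|affine_group n|.
Proof.
set I := fpf_involutions _; set t := affine_perm (n := n) 1%R 1%g.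
have tE x : t x = (x + 1)%R by rewrite permE /= mul1r.
have tG : t \in affine_group n by apply/imsetP; exists (1%R, 1%g).
have sIG : I \subset affine_group n.
  by apply/subsetP => p; rewrite inE => /andP[].
have stIG : (I :* t)%g \subset affine_group n.
  apply/subsetP => _ /rcosetP[p pI ->].
  by rewrite groupM // (subsetP sIG).
have disj : [disjoint I & (I :* t)%g].
  rewrite disjoint_sym; apply/pred0P => q /=.
  apply/negP => /andP[/rcosetP[p pI ->]].
  move: pI; rewrite inE => /and3P[/imsetP[[u v] _ ->] /eqP pp1 /forallP nofix].
  rewrite inE => /and3P[_ /eqP qq1 /forallP nofix1].
  have pE x : affine_perm u v x = (val v * x + u)%R by rewrite permE.
  have pu : (val v * u + u = 0)%R.
    by have /permP/(_ 0%R) := pp1; rewrite permM !pE perm1 mulr0 add0r.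
  have qu : (val v * (u + 1) + (u + 1) = 0)%R.
    have /permP/(_ 0%R) := qq1.
    by rewrite !permM !tE !pE perm1 mulr0 add0r -addrA.
  have v1 : (val v = -1)%R.
    apply/eqP; rewrite -addr_eq0; apply/eqP.
    by rewrite -qu mulrDr mulr1 addrACA pu add0r.
  (* [y] is half of [u], rounded down, so [u] is [2 y] or [2 y + 1]; the fixed
     point is [y] for the first map or [y + 1] for the second. *)
  pose y : 'Z_n := ((u : nat)./2)%:R%R.
  have uE : u = (y + y + (odd u)%:R)%R.
    by rewrite -!natrD addnn addnC odd_double_half natr_Zp.
  case odd_u: (odd u) uE => uE.
    have /eqP[] := nofix1 (y + 1)%R.
    by rewrite permM tE pE v1 mulN1r uE [(y + y + _)%R]addrAC addKr.
  have /eqP[] := nofix y.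
  by rewrite pE v1 mulN1r uE addr0 addKr.
rewrite -addnn -{2}(card_rcoset I t).
have /eqP <- : #|I :|: (I :* t)%g| == #|I| + #|(I :* t)%g|.
  by rewrite (leq_card_setU I (I :* t)%g).2.
by apply: subset_leq_card; rewrite subUset sIG.
Qed.

Theorem mainTheorem2 (k : nat) (hk : 1 <= k) (A : {set {set 'Z_(2 * k)}})
    (hA : strong_antichain (affine_group (2 * k)) A) :
  #|A| <= 2 ^ (k - 1).
Proof.
have cardS : (#|'Z_(2 * k)|)./2 = k.
  rewrite card_ord Zp_cast; first by rewrite mul2n doubleK.
  by rewrite mul2n -addnn (leq_add hk hk).
have := strong_antichain_bound _ _ hA; rewrite cardS => bound.
rewrite -(leq_pmul2r (cardG_gt0 (affine_group (2 * k)))) -leq_double.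
have pow2k : (2 ^ (k - 1)).*2 = 2 ^ k by rewrite -mul2n -expnS subn1 prednK.
rewrite (doubleMl (2 ^ _)) pow2k.
apply: leq_trans (leq_mul (leqnn _) (card_affine_fpf_involutions _)).
by rewrite -doubleMr leq_double [leqRHS]mulnC.
Qed.
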